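(* Let $G$ be a connected plane bipartite graph with color classes $E$ and $V$, let $G^*$ be its directed planar dual, and fix an arbitrary vertex $r_0$ of $G^*$ (the root). For each spanning arborescence $A$ of $G^*$ rooted at $r_0$, let $\Gamma_A$ be the spanning tree of $G$ dual to $A$, and let $\sigma_A=\operatorname{Conv}\{\mathbf e+\mathbf v\mid ev\in\Gamma_A\}$ be the corresponding maximal simplex in the root polytope $Q_G$. Then the collection of simplices $\sigma_A$, where $A$ ranges over all spanning arborescences of $G^*$ rooted at $r_0$, is a triangulation of $Q_G$.
   Context: All graphs are finite; multiple edges are allowed. A plane graph is (an isotopy class of) a graph embedded in the plane, equivalently in the oriented sphere $S^2$. Dual graph: the vertex set of $G^*$ is the set $R$ of regions of $G$ (connected components of $S^2\setminus G$), and $G^*$ has one edge crossing each edge of $G$. Each edge of $G^*$ is directed so that, traversing it, one has the endpoint in $E$ of the crossed edge of $G$ on the right and the endpoint in $V$ on the left. $G^*$ may have loops and multiple edges. Spanning arborescence of $G^*$ rooted at $r_0$: a spanning tree of $G^*$ in which there is a directed path from $r_0$ to every other vertex (every edge points away from $r_0$). The dual subgraph $\Gamma_A$ of $A$ consists of those edges of $G$ whose dual edges are not in $A$; it is a spanning tree of $G$ when $A$ is a spanning tree of $G^*$. Root polytope: for $e\in E$, $v\in V$ let $\mathbf e,\mathbf v$ be the corresponding standard generators of $\mathbf R^E\oplus\mathbf R^V$, and $Q_G=\operatorname{Conv}\{\mathbf e+\mathbf v\mid ev\text{ is an edge of }G\}$. It has dimension $|E|+|V|-2$. A set of vertices of $Q_G$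 is affinely independent iff the corresponding edges form a cycle-free subgraph of $G$; thus maximal (i.e. $(|E|+|V|-2)$-dimensional) simplices formed by vertices of $Q_G$ correspond to spanning trees of $G$. Triangulation of $Q_G$: a collection of maximal simplices, with vertices among the vertices of $Q_G$, whose union is $Q_G$ and any two of which intersect in a common face. *)

(* Defs.v *)
From mathcomp Require Import all_boot all_order all_fingroup all_algebra.
From mathcomp Require Import classical_sets reals.

Set Implicit Arguments.
Unset Strict Implicit.
Unset Printing Implicit Defensive.

Import Order.TTheory GRing.Theory Num.Theory.

(* Finite directed multigraphs, loops allowed.  The undirected notions below
   are those of the underlying undirected multigraph. *)
Record digraph := Digraph {
  vertex : finType;
  darc : finType;
  src : darc -> vertex;
  tgt : darc -> vertex }.

Section Digraph.
Variable D : digraph.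
Implicit Types (A : {set darc D}) (x y : vertex D).

(* A step is an arc together with a direction of travel: [(a, true)] follows
   [a], and [(a, false)] runs against it. *)
Definition step : Type := (darc D * bool)%type.
Definition step_from (s : step) := if s.2 then src s.1 else tgt s.1.
Definition step_to (s : step) := if s.2 then tgt s.1 else src s.1.

Definition linked A : rel (vertex D) := fun x y =>
  [exists s : darc D * bool,
    [&& s.1 \in A, step_from s == x & step_to s == y]].

Definition dlinked A : rel (vertex D) := fun x y =>
  [exists a in A, (src a == x) && (tgt a == y)].

Definition spanning_connected A : Prop :=
  0 < #|vertex D| /\ forall x y, connect (linked A) x y.

(* Cycles have length at least 1: a loop is a cycle, and so is a pair of
   parallel arcs. *)
Definition is_cycle (p : seq step) : bool :=
  [&& p != [::],
      path.cycle (fun s t => step_to s == step_from t) p,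
      uniq (map fst p) & uniq (map step_from p)].

Definition acyclic A : Prop :=
  forall p : seq step, is_cycle p -> ~~ all (fun s => s.1 \in A) p.

Definition spanning_tree A : Prop := spanning_connected A /\ acyclic A.

Definition arborescence (r : vertex D) A : Prop :=
  spanning_tree A /\ forall x, connect (dlinked A) r x.

End Digraph.

(* A bipartite multigraph, with colour classes [classE] and [classV], drawn on
   an oriented closed surface.  The drawing of a connected graph is given, up to
   isotopy, by its rotation system: [rotE a] (resp. [rotV a]) is the edge that
   follows [a] in the counterclockwise order around its endpoint in [classE]
   (resp. [classV]).  The star conditions say that the edges at each vertex form
   a single cycle of the rotation. *)
Record bimap := Bimap {
  classE : finType;
  classV : finType;
  edge : finType;
  endE : edge -> classE;
  endV : edge -> classV;
  rotE : {perm edge};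
  rotV : {perm edge};
  rotE_star : forall a, porbit rotE a = [set b | endE b == endE a];
  rotV_star : forall a, porbit rotV a = [set b | endV b == endV a] }.

Section Bimap.
Variable G : bimap.

Definition graph_of : digraph :=
  @Digraph (classE G + classV G)%type (edge G) (fun a => inl (endE a))
    (fun a => inr (endV a)).

Definition connected_map : Prop := spanning_connected [set: darc graph_of].

(* [(a, true)] is [a] traversed from [classE] to [classV], and [(a, false)] is
   [a] traversed from [classV] to [classE]. *)
Definition dart : finType := (edge G * bool)%type.

(* The next dart along the boundary of the region on the left: at the far end
   of the dart, leave along the clockwise neighbour. *)
Definition face (d : dart) : dart :=
  if d.2 then ((rotV G)^-1%g d.1, false) else ((rotE G)^-1%g d.1, true).

Definition left_boundary (d : dart) : {set dart} :=
  [set d' | fconnect face d d'].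

(* A region is represented by the set of darts having it on their left, that
   is, by its boundary walk.  Only when [G] has no edge is there a region with
   empty boundary: the complement of the isolated vertex. *)
Definition is_region (r : {set dart}) : bool :=
  [exists d, r == left_boundary d] || (r == finset.set0) && (#|edge G| == 0).

Definition region : finType := {r : {set dart} | is_region r}.

Lemma left_boundary_region d : is_region (left_boundary d).
Proof. by apply/orP; left; apply/existsP; exists d. Qed.

Definition left_region (d : dart) : region :=
  exist _ (left_boundary d) (left_boundary_region d).

(* A connected map lies on the sphere iff its Euler characteristic is 2. *)
Definition plane : Prop :=
  #|classE G| + #|classV G| + #|{: region}| = #|edge G| + 2.

(* The dual of [a] is also named [a].  It crosses [a] with the endpoint of [a]
   in [classE] on its right, hence goes from the region on the left of
   [(a, true)] to the one on its right. *)
Definition dual : digraph :=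
  @Digraph region (edge G) (fun a => left_region (a, true))
    (fun a => left_region (a, false)).

Definition dual_subgraph (A : {set darc dual}) : {set edge G} :=
  [set a : edge G | a \notin A].

End Bimap.

Local Open Scope classical_set_scope.
Local Open Scope ring_scope.

Section Polytopes.
Variables (R : realType) (W : lmodType R).
Implicit Types (X Q s f : set W) (T : set (set W)).

Definition Conv X : set W := [set x | exists n (p : 'I_n -> W) (c : 'I_n -> R),
  [/\ forall i, X (p i), forall i, 0 <= c i, \sum_i c i = 1
    & x = \sum_i c i *: p i]].

Definition vertices Q : set W := [set x | Q x /\
  forall (y z : W) (c : R), Q y -> Q z -> 0 < c < 1 ->
    x = c *: y + (1 - c) *: z -> y = x /\ z = x].

Definition affinely_independent n (p : 'I_n -> W) : Prop :=
  forall c : 'I_n -> R, \sum_i c i = 0 -> \sum_i c i *: p i = 0 ->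
    forall i, c i = 0.

(* [s] is a simplex with [n] vertices, that is, of dimension [n - 1], all of
   them vertices of [Q]. *)
Definition simplex_in Q n s : Prop :=
  exists p : 'I_n -> W, [/\ forall i, vertices Q (p i),
    affinely_independent p & s = Conv (range p)].

(* Faces of a simplex [s]; the empty face is included. *)
Definition simplex_face s f : Prop :=
  exists2 F : set W, F `<=` vertices s & f = Conv F.

Definition triangulation Q n T : Prop :=
  [/\ forall s, T s -> simplex_in Q n s,
      \bigcup_(s in T) s = Q
    & forall s t, T s -> T t ->
        simplex_face s (s `&` t) /\ simplex_face t (s `&` t)].

End Polytopes.

Section RootPolytope.
Variables (R : realType) (G : bimap).

Definition ambient : lmodType R :=
  ({ffun classE G -> R^o} * {ffun classV G -> R^o})%type.

Definition gen_E (e : classE G) : ambient := ([ffun x => (x == e)%:R], 0).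
Definition gen_V (v : classV G) : ambient := (0, [ffun x => (x == v)%:R]).

Definition edge_polytope (B : {set edge G}) : set ambient :=
  Conv [set gen_E (endE a) + gen_V (endV a) | a in [set` B]].

Definition root_polytope : set ambient := edge_polytope finset.setT.

Definition arborescence_simplex (A : {set darc (dual G)}) : set ambient :=
  edge_polytope (dual_subgraph A).

End RootPolytope.

Arguments root_polytope : clear implicits.
Arguments arborescence_simplex R {G} A.

(* Main.v *)
(* Write [x a] for the vertex [e + v] of the root polytope given by an edge
   [a = ev].  A linear relation among the [x a] is a circulation of [G] oriented
   from [E] to [V], that is, by planarity, a coboundary
   [g (src a) - g (tgt a)] of a function [g] on the regions.  Hence the convex
   representations of a point [sum_a z a * x a] are the nonnegative functions
   [z + coboundary g].  Reading [z] as arc lengths of the dual graph, such a [g]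
   is a feasible potential for the shortest path problem from [r0].  A
   shortest path arborescence [A] gives one that makes [z + coboundary g]
   vanish on [A], so the point lies in the simplex of [A].  Conversely, if [z]
   vanishes on an arborescence [A] and [z + coboundary g] on an arborescence
   [A'], then [g] decreases along [A] and increases along [A'] away from [r0],
   so [g] is constant: the two simplices meet in the face spanned by the edges
   outside both [A] and [A']. *)
Require Import Defs.
From mathcomp Require Import all_boot all_order all_fingroup all_algebra.
From mathcomp Require Import boolp classical_sets reals ring.

Set Implicit Arguments.
Unset Strict Implicit.
Unset Printing Implicit Defensive.

Import Order.TTheory GRing.Theory Num.Theory.

(** * Directed multigraphs: paths, cycles and the growth of arborescences *)

Section Digraphs.
Import fintype finset.
Variable D : digraph.
Implicit Types (A T : {set darc D}) (S : {set vertex D}) (x y r : vertex D).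

Lemma linked_sym A x y : linked A x y = linked A y x.
Proof.
suff H u v : linked A u v -> linked A v u by apply/idP/idP; apply: H.
case/existsP=> -[a b] /and3P[/= aA /eqP <- /eqP <-].
apply/existsP; exists (a, ~~ b); rewrite /= aA /step_from /step_to.
by case: b; rewrite /= !eqxx.
Qed.

Lemma dlinked_arc A a : a \in A -> dlinked A (src a) (tgt a).
Proof. by move=> aA; apply/existsP; exists a; rewrite aA !eqxx. Qed.

Lemma connect_linked_const A (U : Type) (f : vertex D -> U) :
  (forall a, a \in A -> f (src a) = f (tgt a)) ->
  forall x y, connect (linked A) x y -> f x = f y.
Proof.
move=> fA; move=> x y /connectP[p + ->] {y}.
elim: p x => [|y p IHp] x //=.
case/andP=> /existsP[[a b] /and3P[/= aA /eqP <- /eqP <-]] pth.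
by rewrite -(IHp _ pth) /step_from /step_to; case: b {pth} => /=; rewrite fA.
Qed.

Lemma dlinked_monotone (d : Order.disp_t) (P : porderType d) A
    (f : vertex D -> P) x y :
  (forall a, a \in A -> (f (tgt a) <= f (src a))%O) ->
  connect (dlinked A) x y -> (f y <= f x)%O.
Proof.
move=> fA /connectP[p + ->] {y}; elim: p x => //= y p IHp x.
case/andP=> /existsP[a /and3P[aA /eqP <- /eqP <-]] /IHp.
by move/le_trans; apply; apply: fA.
Qed.

Lemma connect_exit A x S :
  x \in S -> (forall y, connect (dlinked A) x y) -> S != [set: vertex D] ->
  exists a, [/\ a \in A, src a \in S & tgt a \notin S].
Proof.
move=> xS con SnT; have [y yS] : exists y, y \notin S.
  apply/existsP; rewrite -negb_forall; apply: contra SnT => /forallP SP.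
  by apply/eqP/setP=> y; rewrite SP inE.
have := con y; case/connectP=> p pth yE; rewrite {y}yE in yS.
elim: p x xS pth yS {con} => [|z p IHp] x xS /=; first by rewrite xS.
case/andP=> /existsP[a /andP[aA /andP[/eqP ax /eqP az]]] pth.
have [zS|zS _] := boolP (z \in S); first exact: IHp.
by exists a; rewrite ax az.
Qed.

(** The arcs are distinct because a second use of the first arc would bring the path back to its
    starting vertex [x]. *)
Lemma linked_path_steps T x p : path (linked T) x p -> uniq (x :: p) ->
  exists ss : seq (step D), [/\ all (fun s => s.1 \in T) ss,
    map (@step_to D) ss = p, map (@step_from D) ss = belast x p
    & uniq (map fst ss)].
Proof.
elim: p x => [|y p IHp] x; first by exists [::].
rewrite [path _ _ _]/= => /andP[/existsP[s /and3P[sT /eqP sx /eqP sy]] pth].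
rewrite cons_uniq => /andP[xNp unq].
have [ss [ssT ssto ssfrom ssu]] := IHp _ pth unq.
exists (s :: ss); split=> /=; rewrite ?sT ?ssto ?ssfrom ?sx ?sy ?ssu ?andbT //.
apply/mapP=> -[t tss st]; case/negP: xNp.
have xt : (x == step_from t) || (x == step_to t).
  rewrite -sx; move: st; rewrite /step_from /step_to.
  by case: (s) (t) => a [] [b []] /= ->; rewrite eqxx ?orbT.
case/orP: xt => /eqP ->; last by rewrite in_cons -ssto map_f ?orbT.
by apply: mem_belast; rewrite -ssfrom map_f.
Qed.

(** Otherwise [a], followed by a simple path in [T] from its head back to its tail, would be a cycle
    in [A]. *)
Lemma acyclic_bridge A T a : acyclic A -> T \subset A -> a \in A ->
  connect (linked T) (tgt a) (src a) -> a \in T.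
Proof.
move=> acA /subsetP TA aA /connectP[p0 pth0 lst].
move: lst; case/shortenP: pth0 => p pth unq _ lst.
have [ss [ssT ssto ssfrom ssu]] := linked_path_steps pth unq.
apply: contraT => aNT.
have aNss : a \notin map fst ss.
  by apply: contra aNT => /mapP[s sss ->]; apply: (allP ssT).
have pthss : path (fun s t : step D => step_to s == step_from t) (a, true) ss
    /\ step_to (last (a, true) ss) = src a.
  have -> : step_to (last (a, true) ss) = last (tgt a) p.
    by rewrite -ssto (last_map (@step_to D) ss (a, true)).
  split=> //; move: ssto ssfrom; rewrite -[tgt a]/(step_to (a, true)).
  elim: ss (a, true) p {ssT ssu aNss pth unq lst} => //= s ss IHss t p <-.
  move=> /= [-> eqs].
  by rewrite eqxx; apply: (IHss _ (map (@step_to D) ss)).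
have cyc : is_cycle ((a, true) :: ss).
  apply/and4P; split=> //=.
  - by rewrite rcons_path pthss.1 pthss.2 /step_from /= eqxx.
  - by rewrite aNss.
  - by rewrite ssfrom /step_from /=; move: unq; rewrite lastI rcons_uniq -lst.
have /negP := acA _ cyc; case; rewrite /= aA /=.
by apply/allP=> s /(allP ssT)/TA.
Qed.

(** Arborescences built from the root one arc at a time: [S] holds the vertices reached so far, [T]
    the arcs used. Each new arc enters a new vertex, so the arc count, reachability and acyclicity
    all follow by induction. *)
Inductive grown r : {set vertex D} -> {set darc D} -> Prop :=
| grown_root : grown r [set r] finset.set0
| grown_arc S T a : grown r S T -> src a \in S -> tgt a \notin S ->
    grown r (tgt a |: S) (a |: T).

Lemma root_in_grown r S T : grown r S T -> r \in S.
Proof. by elim=> [|S' T' a _ rS _ _]; rewrite ?set11 // inE rS orbT. Qed.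

Lemma grown_ends r S T : grown r S T ->
  {in T, forall a, src a \in S /\ tgt a \in S}.
Proof.
elim=> [a|S' T' a _ IH aS _ b]; first by rewrite finset.in_set0.
rewrite !inE => /predU1P[->|/IH[-> ->]]; last by rewrite !orbT.
by rewrite aS eqxx orbT.
Qed.

Lemma grown_card r S T : grown r S T -> #|S| = #|T|.+1.
Proof.
elim=> [|S' T' a grw IH _ aS]; first by rewrite cards1 cards0.
rewrite !cardsU1 aS IH; suff -> : a \notin T' by [].
by apply: contra aS => /(grown_ends grw)[].
Qed.

Lemma grown_connect r S T : grown r S T ->
  {in S, forall x, connect (dlinked T) r x}.
Proof.
elim=> [x|S' T' a _ IH aS _ x]; first by rewrite inE => /eqP ->.
have sub : subrel (connect (dlinked T')) (connect (dlinked (a |: T'))).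
  apply: connect_sub => u v /existsP[b /andP[bT uv]]; apply: connect1.
  by apply/existsP; exists b; rewrite inE bT orbT.
rewrite !inE => /predU1P[->|/IH/sub //].
apply: connect_trans (sub _ _ (IH _ aS)) (connect1 (dlinked_arc _)).
by rewrite setU11.
Qed.

Lemma is_cycle_rot n (p : seq (step D)) : is_cycle (rot n p) = is_cycle p.
Proof.
rewrite /is_cycle rot_cycle !map_rot !rot_uniq.
by rewrite -!size_eq0 size_rot.
Qed.

(* The head of the last arc added meets no other arc, so no cycle uses it. *)
Lemma grown_acyclic r S T : grown r S T -> acyclic T.
Proof.
elim=> [|S' T' a grw IH aS aNS] p cyc.
  by case: p cyc => // s p _; rewrite /= inE.
apply/negP=> pT; case: (boolP (has (fun s => s.1 == a) p)) => [|aNp]; last first.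
  case/negP: (IH _ cyc); apply/allP=> s sp.
  have := allP pT _ sp; rewrite inE => /orP[|//]; rewrite inE => sa.
  by case/negP: aNp; apply/hasP; exists s.
case/hasP=> s sp /eqP sa; case: (rot_to sp) => i q rotp.
have {cyc} : is_cycle (s :: q) by rewrite -rotp is_cycle_rot.
have {pT} : all (fun s => s.1 \in a |: T') (s :: q).
  by rewrite -rotp (eq_all_r (mem_rot _ _)).
case/andP=> _ qT /and4P[_ cyc /= /andP[sNq _] _].
have {qT} qT t : t \in q -> step_from t \in S' /\ step_to t \in S'.
  move=> tq; have := allP qT _ tq; rewrite !inE => /predU1P[ta|].
    by case/negP: sNq; rewrite sa -ta map_f.
  by case/(grown_ends grw); rewrite /step_from /step_to; case: (t.2).
(* Alone in the cycle, [a] would be a loop, but only its tail lies in [S']. Otherwise the step next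
   to [s] at the head of [a] has both ends in [S']. *)
case: q cyc qT {sNq rotp} => [|t q] /=.
  rewrite andbT /step_to /step_from sa; case: (s.2) => /eqP eqa _.
    by rewrite -eqa (negPf aNS) in aS.
  by rewrite eqa (negPf aNS) in aS.
case/andP=> /eqP st cyc qT; move: cyc; rewrite rcons_path => /andP[_ /eqP ts].
move: st ts; rewrite {1}/step_to {2}/step_from sa.
case: (s.2) => [st _|_ ts].
  by case: (qT t); rewrite ?mem_head // -st (negPf aNS).
by case: (qT (last t q)); rewrite ?mem_last // ts (negPf aNS).
Qed.

Lemma grown_spanning_connected r T : grown r [set: vertex D] T ->
  spanning_connected T.
Proof.
move=> grw; split; first by apply/card_gt0P; exists r.
have con x : connect (linked T) r x.
  have := grown_connect grw (finset.in_setT x); apply: connect_sub => u v.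
  case/existsP=> a /and3P[aT /eqP <- /eqP <-]; apply: connect1.
  by apply/existsP; exists (a, true); rewrite /= aT !eqxx.
move=> x y; apply: connect_trans (con y).
by rewrite (sym_connect_sym (linked_sym T)).
Qed.

Lemma grown_arborescence r T : grown r [set: vertex D] T -> arborescence r T.
Proof.
move=> grw; split; first split.
- exact: grown_spanning_connected grw.
- exact: grown_acyclic grw.
- by move=> x; apply: (grown_connect grw); rewrite inE.
Qed.

(** Greedy growth under an invariant [P], which will be containment in a given arborescence or the
    existence of a potential that is tight on [T]. *)
Lemma grown_full r (P : {set darc D} -> Prop) :
  P finset.set0 ->
  (forall S T, grown r S T -> P T -> S != [set: vertex D] ->
     exists a, [/\ src a \in S, tgt a \notin S & P (a |: T)]) ->
  exists2 T, grown r [set: vertex D] T & P T.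
Proof.
move=> P0 Pstep.
suff H n S T : #|~: S| <= n -> grown r S T -> P T ->
    exists2 T, grown r [set: vertex D] T & P T.
  exact: H (leqnn _) (grown_root r) P0.
elim: n S T => [|n IHn] S T; rewrite ?leqn0 ?cards_eq0 => leS grw PT.
  by exists T; rewrite // -finset.setC0 -(eqP leS) finset.setCK.
have [SE|SnT] := eqVneq S [set: vertex D]; first by exists T; rewrite -?SE.
have [a [aS aNS PaT]] := Pstep _ _ grw PT SnT.
apply: (IHn _ _ _ (grown_arc grw aS aNS) PaT).
rewrite -ltnS; apply: leq_trans leS; apply: proper_card.
rewrite finset.properEneq finset.setCS finset.subsetUr andbT.
by apply: contraNneq aNS => /finset.setC_inj <-; rewrite setU11.
Qed.

(** Growth inside [A] stops only at a spanning [T]. Any arc of [A] then joins vertices connected in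
    [T], so acyclicity puts it in [T]. This makes [grown_card] available for [A]. *)
Lemma arborescence_grown r A : arborescence r A -> grown r [set: vertex D] A.
Proof.
case=> -[_ acA] con.
have [|S T grw TA SnT|T grw TA] :=
  @grown_full r (fun T => T \subset A); first exact: finset.sub0set.
  have [a [aA aS aNS]] := connect_exit (root_in_grown grw) con SnT.
  by exists a; rewrite finset.subUset finset.sub1set aA.
suff -> : A = T by [].
apply/eqP; rewrite finset.eqEsubset TA andbT; apply/subsetP=> a aA.
by apply: acyclic_bridge TA aA _ => //; case: (grown_spanning_connected grw).
Qed.

End Digraphs.

(** * Regions of a bipartite map and coboundaries on its dual *)

Section Maps.
Variable G : bimap.
Implicit Types (a b : edge G) (w : vertex (graph_of G)) (r : region G).

Definition incident w a : bool :=
  match w with inl e => endE a == e | inr v => endV a == v end.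

Lemma endE_rot a : endE (rotE G a) = endE a.
Proof. by apply/eqP; have := mem_porbit (rotE G) 1 a; rewrite rotE_star inE. Qed.

Lemma endV_rot a : endV (rotV G a) = endV a.
Proof. by apply/eqP; have := mem_porbit (rotV G) 1 a; rewrite rotV_star inE. Qed.

Lemma face_inj : injective (@face G).
Proof.
by move=> [a []] [b []] //= [] // /perm_inj ->.
Qed.

Lemma left_region_face (d : dart G) : left_region (face d) = left_region d.
Proof.
apply/val_inj/setP=> d'; rewrite /= !inE.
by rewrite -(same_fconnect1 face_inj).
Qed.

(** The duals of the edges around a vertex of [classE] form a closed directed walk: that of
    [rotE G a] ends where that of [a] starts. By the next lemma the same holds in [classV], in the
    opposite sense of rotation. *)
Lemma left_region_rotE a : left_region (a, true) = left_region (rotE G a, false).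
Proof. by rewrite -[RHS]left_region_face /face /= permK. Qed.

Lemma left_region_rotV a : left_region (a, false) = left_region (rotV G a, true).
Proof. by rewrite -[RHS]left_region_face /face /= permK. Qed.

Lemma porbit_const (U : Type) (s : {perm edge G}) (h : edge G -> U) a b :
  (forall c, h (s c) = h c) -> b \in porbit s a -> h b = h a.
Proof.
move=> hs /porbitP[n ->]; rewrite permX.
by elim: n => //= n IHn; rewrite hs.
Qed.

(** Connectedness of the dual, in terms of functions. The common value [h a] of [g] on the two sides
    of [a] is constant around each vertex of [G], hence on all edges since [G] is connected. *)
Lemma region_const (U : Type) (g : vertex (dual G) -> U) :
  connected_map G -> (forall a : darc (dual G), g (src a) = g (tgt a)) ->
  forall r r', g r = g r'.
Proof.
move=> [_ connG] gE; pose h a := g (left_region (a, true)).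
have hE b : h (rotE G b) = h b.
  by rewrite /h (left_region_rotE b); apply: (gE (rotE G b)).
have hV b : h (rotV G b) = h b.
  by rewrite /h -left_region_rotV; exact: (esym (gE _)).
have h_at w a b : incident w a -> incident w b -> h a = h b.
  case: w => [e|v] /= /eqP <- /eqP ab.
    by apply: porbit_const hE _; rewrite rotE_star inE ab.
  by apply: porbit_const hV _; rewrite rotV_star inE ab.
have h_const a b : h a = h b.
  (* [P] is carried along the edges of [G] as a function with values in [Prop]. *)
  pose P w := forall c, incident w c -> h c = h a.
  have PE : P (inl (endE a)) = P (inl (endE b)).
    apply: (connect_linked_const (A := [set: darc (graph_of G)])) (connG _ _).
    move=> c _; apply/propext; rewrite /src /tgt /=.
    split=> Pc c' inc; rewrite -(Pc c) /incident ?eqxx //; apply: h_at inc _;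
      by rewrite /incident eqxx.
  suff : P (inl (endE b)) by move/(_ b) => ->; rewrite /incident ?eqxx.
  by rewrite -PE => c inc; apply: h_at inc _; rewrite /incident eqxx.
have gd (d d' : dart G) : g (left_region d) = g (left_region d').
  have gh (d0 : dart G) : g (left_region d0) = h d0.1.
    by case: d0 => a [] //=; exact: (esym (gE _)).
  by rewrite !gh; apply: h_const.
(* A region with empty boundary occurs only when there is no edge, and then it is the only
   region. *)
have regionP r : (exists d, r = left_region d) \/
    (val r = finset.set0 /\ #|edge G| = 0).
  have := valP r => /orP[/existsP[d /eqP rd]|/andP[/eqP r0 /eqP]]; last by right.
  by left; exists d; apply: val_inj.
move=> r r'; case: (regionP r) (regionP r') => [[d ->]|[r0 N0]].
  by case=> [[d' ->]|[_ /card0_eq/(_ d.1)]]; [apply: gd | rewrite inE].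
case=> [[d' ->]|[r'0 _]]; first by have := card0_eq N0 d'.1; rewrite inE.
by congr g; apply: val_inj; rewrite r0 r'0.
Qed.

Local Open Scope ring_scope.

Definition coboundary (F : zmodType) (g : vertex (dual G) -> F) a : F :=
  g (@src (dual G) a) - g (@tgt (dual G) a).

(** The sum telescopes along the closed walk of dual edges around [w]: the rotation at [w] matches
    tails with heads. *)
Lemma coboundary_circulation (F : zmodType) (g : vertex (dual G) -> F) w :
  \sum_(a | incident w a) coboundary g a = 0.
Proof.
rewrite /coboundary sumrB /src /tgt /=; apply/eqP; rewrite subr_eq0; apply/eqP.
case: w => [e|v] /=.
  under eq_bigr => a _ do rewrite left_region_rotE.
  rewrite [RHS](reindex_inj (@perm_inj _ (rotE G))).
  by apply: eq_bigl => a; rewrite endE_rot.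
under [RHS]eq_bigr => a _ do rewrite left_region_rotV.
rewrite [LHS](reindex_inj (@perm_inj _ (rotV G))).
by apply: eq_bigl => a; rewrite endV_rot.
Qed.

(** Without an exit, the coboundary of the indicator of [S] would be nonpositive. It sums to zero at
    each vertex of [classE], hence in total, so it vanishes and the indicator is constant. Thus the
    dual is strongly connected. *)
Lemma dual_exit (S : {set vertex (dual G)}) r : connected_map G -> r \in S ->
  S != finset.setT -> exists a : darc (dual G), src a \in S /\ tgt a \notin S.
Proof.
move=> connG rS ST; apply/not_existsP => none; case/negP: ST.
pose g (r : vertex (dual G)) : int := (r \in S)%:R.
have g0 a : 0 <= - coboundary g a.
  rewrite oppr_ge0 subr_le0 /g ler_nat; have := none a.
  by case: (@src (dual G) a \in S); case: (@tgt (dual G) a \in S) => // -[].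
have sum0 : \sum_a - coboundary g a = 0.
  rewrite sumrN (partition_big (@endE G) predT) //= big1 ?oppr0 // => e _.
  exact: (coboundary_circulation g (inl e)).
have gE a : g (@src (dual G) a) = g (@tgt (dual G) a).
  apply/eqP; rewrite -subr_eq0 -oppr_eq0.
  by rewrite (psumr_eq0P (fun a _ => g0 a) sum0).
apply/eqP/setP => r'; rewrite !inE; have := region_const connG gE r' r.
by rewrite /g rS; case: (r' \in S) => // /eqP; rewrite eq_sym oner_eq0.
Qed.

End Maps.

(** * Exactness: circulations are coboundaries *)

Section Exactness.
Local Open Scope ring_scope.

Lemma corank1 (F : fieldType) m n (A : 'M[F]_(m, n)) (w : 'rV[F]_m) :
  (forall u : 'rV[F]_m, u *m A = 0 -> exists c, u = c *: w) ->
  (m <= (\rank A).+1)%N.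
Proof.
move=> kerA; have : (kermx A <= w)%MS.
  apply/row_subP=> i; apply/sub_rVP; apply: kerA.
  by rewrite -row_mul mulmx_ker row0.
move/mxrankS/leq_trans/(_ (rank_leq_row _)).
by rewrite mxrank_ker leq_subLR addn1.
Qed.

(* The cycle space of [G] is the cut space of its dual: one inclusion is
   [coboundary_circulation], and the dimensions agree by Euler's formula. *)
Lemma circulation_coboundary (F : fieldType) (G : bimap) (z : edge G -> F) :
  connected_map G -> plane G ->
  (forall w, \sum_(a | incident w a) z a = 0) ->
  exists g, forall a, z a = coboundary g a.
Proof.
move=> connG planeG zcirc.
pose W := (classE G + classV G)%type.
(* The rows of [D] are the coboundaries of the indicators of regions, and [M] is the unsigned
   incidence matrix of [G]. The aim is that the row space of [D] be the left kernel of [M]. *)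
pose D : 'M[F]_(#|{: region G}|, #|edge G|) :=
  \matrix_(i, j) coboundary (fun r => (r == enum_val i)%:R) (enum_val j).
pose M : 'M[F]_(#|edge G|, #|{: W}|) :=
  \matrix_(j, k) (incident (enum_val k : W) (enum_val j))%:R.
have uD (u : 'rV[F]_#|{: region G}|) j :
    (u *m D) 0 j = coboundary (fun r => u 0 (enum_rank r)) (enum_val j).
  rewrite mxE /coboundary.
  under eq_bigr => i _ do rewrite mxE /coboundary mulrBr.
  have sum_delta r : \sum_i u 0 i * (r == enum_val i)%:R = u 0 (enum_rank r).
    rewrite (bigD1 (enum_rank r)) //= enum_rankK eqxx mulr1 big1 ?addr0 // => i ir.
    suff /negPf -> : r != enum_val i by rewrite mulr0.
    by apply: contraNneq ir => ->; rewrite enum_valK.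
  by rewrite sumrB !sum_delta.
have uM (u : 'rV[F]_#|edge G|) k :
    (u *m M) 0 k = \sum_(a | incident (enum_val k : W) a) u 0 (enum_rank a).
  rewrite mxE (reindex enum_rank) /=; last by apply/onW_bij/enum_rank_bij.
  rewrite [RHS]big_mkcond; apply: eq_bigr => a _; rewrite mxE enum_rankK.
  by case: incident; rewrite ?mulr1 ?mulr0.
have uMt (u : 'rV[F]_#|{: W}|) j : let a := enum_val j in
    (u *m M^T) 0 j = u 0 (enum_rank (inl (endE a) : W))
                     + u 0 (enum_rank (inr (endV a) : W)).
  move=> a; rewrite mxE (reindex enum_rank) /=; last first.
    by apply/onW_bij/enum_rank_bij.
  under eq_bigr => w _ do rewrite !mxE enum_rankK -/a.
  rewrite (bigD1 (inl (endE a))) //= eqxx mulr1; congr (_ + _).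
  rewrite (bigD1 (inr (endV a))) //= eqxx mulr1 big1 ?addr0 //.
  case=> [e|v] /andP[/= w1 w2].
    suff /negPf -> : endE a != e by rewrite mulr0.
    by apply: contraNneq w1 => ->.
  suff /negPf -> : endV a != v by rewrite mulr0.
  by apply: contraNneq w2 => ->.
have DM : (D <= kermx M)%MS.
  apply/row_subP=> i; apply/sub_kermxP/rowP=> k; rewrite uM [RHS]mxE.
  rewrite -[RHS](coboundary_circulation (fun r => (r == enum_val i)%:R) (enum_val k)).
  by apply: eq_bigr => a _; rewrite !mxE enum_rankK.
(* A vector killed by [D] is a function on regions with zero coboundary, hence constant. *)
have rkD : (#|{: region G}| <= (\rank D).+1)%N.
  apply: (@corank1 _ _ _ _ (const_mx 1)) => u u0.
  have [r0 _|none] := pickP {: region G}; last first.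
    by exists 0; apply/rowP=> i; have := none (enum_val i).
  exists (u 0 (enum_rank r0)); apply/rowP=> i; rewrite !mxE mulr1.
  rewrite -[i]enum_valK.
  apply: (@region_const G F (fun r => u 0 (enum_rank r)) connG) => a.
  by apply/subr0_eq; have := uD u (enum_rank a); rewrite u0 mxE enum_rankK.
(* A vector killed by [M^T] takes opposite values at the two ends of each edge; multiplied by the
   signs [sgn] of the colour classes, it becomes constant. *)
have rkM : (#|{: W}| <= (\rank M).+1)%N.
  rewrite -mxrank_tr.
  pose sgn (w : W) : F := if w is inl _ then 1 else -1.
  apply: (@corank1 _ _ _ _ (\row_k sgn (enum_val k))) => u u0.
  case: (connG) => /card_gt0P[w0 _] con.
  exists (u 0 (enum_rank (w0 : W)) * sgn w0); apply/rowP=> k; rewrite !mxE.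
  have : sgn w0 * u 0 (enum_rank (w0 : W)) = sgn (enum_val k) * u 0 k.
    rewrite -{2}[k]enum_valK.
    pose f (w : vertex (graph_of G)) := sgn w * u 0 (enum_rank (w : W)).
    suff fE a : a \in [set: darc (graph_of G)] -> f (src a) = f (tgt a).
      exact (@connect_linked_const _ _ _ f fE _ _ (con w0 (enum_val k))).
    rewrite /f /sgn /src /tgt /= mul1r mulN1r => _; apply/eqP.
    rewrite -addr_eq0; apply/eqP.
    by have := uMt u (enum_rank a); rewrite u0 mxE /= enum_rankK.
  rewrite [_ * sgn w0]mulrC => ->; rewrite mulrC mulrA.
  by rewrite /sgn; case: (enum_val k) => _; rewrite ?mulrNN !mul1r.
have KD : (kermx M <= D)%MS.
  have [le eqv] := mxrank_leqif_sup DM; rewrite -eqv eqn_leq le /=.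
  (* The kernel of [M] has dimension at most [#|edge G| - #|W| + 1]. By Euler's formula this is the
     number of regions minus 1, which is at most the rank of [D]. *)
  have euler : (#|{: W}| + #|{: region G}| = #|edge G| + 2)%N.
    by rewrite -planeG; congr (_ + _)%N; apply: card_sum.
  rewrite mxrank_ker leq_subLR -2!ltnS -addn2 -euler -addnS -addSn.
  exact: leq_add.
have /submxP[u zu] : ((\row_j z (enum_val j)) <= D)%MS.
  apply: submx_trans KD; apply/sub_kermxP/rowP=> k; rewrite uM mxE.
  rewrite -[RHS](zcirc (enum_val k)); apply: eq_bigr => a _.
  by rewrite mxE enum_rankK.
exists (fun r => u 0 (enum_rank r)) => a.
by rewrite -{2}[a]enum_rankK -uD -zu mxE enum_rankK.
Qed.

End Exactness.

(** * Points of the root polytope as nonnegative functions on the edges *)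

Section Triangulation.
Local Open Scope classical_set_scope.
Local Open Scope ring_scope.
Variables (R : realType) (G : bimap).
Implicit Types (a b : edge G) (z : edge G -> R) (B : {set edge G})
  (q : ambient R G).

Definition edge_point a : ambient R G := gen_E R (endE a) + gen_V R (endV a).

Definition comb z : ambient R G := \sum_a z a *: edge_point a.

Lemma edge_point_fst a e : (edge_point a).1 e = (endE a == e)%:R.
Proof. by rewrite /edge_point /= !ffunE addr0 eq_sym. Qed.

Lemma edge_point_snd a v : (edge_point a).2 v = (endV a == v)%:R.
Proof. by rewrite /edge_point /= !ffunE add0r eq_sym. Qed.

Lemma comb_fst z e : (comb z).1 e = \sum_(a | endE a == e) z a.
Proof.
rewrite /comb raddf_sum sum_ffunE [RHS]big_mkcond /=; apply: eq_bigr => a _.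
rewrite ffunE /= edge_point_fst; case: eqP => _; first exact: mulr1.
exact: mulr0.
Qed.

Lemma comb_snd z v : (comb z).2 v = \sum_(a | endV a == v) z a.
Proof.
rewrite /comb raddf_sum sum_ffunE [RHS]big_mkcond /=; apply: eq_bigr => a _.
rewrite ffunE /= edge_point_snd; case: eqP => _; first exact: mulr1.
exact: mulr0.
Qed.

(** Every edge has exactly one end in [classE], so the total weight depends on the point only: a
    change of representation keeps the coefficients summing to 1. *)
Lemma sum_comb z : \sum_a z a = \sum_e (comb z).1 e.
Proof.
rewrite (partition_big (@endE G) predT) //=.
by apply: eq_bigr => e _; rewrite comb_fst.
Qed.

Lemma comb_eqP z z' :
  (forall w, \sum_(a | incident w a) z a = \sum_(a | incident w a) z' a) <->
  comb z = comb z'.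
Proof.
split=> [zz'|zz' [e|v]] /=; last 2 first.
- by rewrite -!comb_fst zz'.
- by rewrite -!comb_snd zz'.
rewrite [LHS]surjective_pairing [RHS]surjective_pairing.
congr pair; apply/ffunP => w.
  by rewrite !comb_fst; apply: (zz' (inl w)).
by rewrite !comb_snd; apply: (zz' (inr w)).
Qed.

(** Collects the coefficients of repeated edges, so that any finite family yields one coefficient
    per edge. *)
Lemma comb_pushforward n (e : 'I_n -> edge G) (c : 'I_n -> R) :
  comb (fun a => \sum_(i | e i == a) c i) = \sum_i c i *: edge_point (e i).
Proof.
rewrite /comb [RHS](partition_big e predT) //=; apply: eq_bigr => a _.
by rewrite scaler_suml; apply: eq_bigr => i /eqP ->.
Qed.

Lemma comb_coboundary z z' g : (forall a, z' a = z a + coboundary g a) ->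
  comb z' = comb z.
Proof.
move=> zz'; apply/comb_eqP => w; under eq_bigr => a _ do rewrite zz'.
by rewrite big_split /= coboundary_circulation addr0.
Qed.

Lemma comb_eq_coboundary z z' : connected_map G -> plane G ->
  comb z = comb z' -> exists g, forall a, z' a = z a + coboundary g a.
Proof.
move=> connG planeG /comb_eqP zz'.
have [|g gE] := circulation_coboundary (z := fun a => z' a - z a) connG planeG.
  by move=> w; rewrite sumrB zz' subrr.
by exists g => a; rewrite -gE addrC subrK.
Qed.

Lemma edge_polytopeP B q : @edge_polytope R G B q <->
  exists z, [/\ forall a, 0 <= z a, forall a, a \notin B -> z a = 0,
    \sum_a z a = 1 & q = comb z].
Proof.
split=> [[n [p [c [pB c0 c1 ->]]]]|[z [z0 zB z1 ->]]].
  have /choice[e eP] : forall i, exists a, a \in B /\ edge_point a = p i.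
    by move=> i; have [a aB <-] := pB i; exists a.
  exists (fun a => \sum_(i | e i == a) c i); split.
  - by move=> a; apply: sumr_ge0.
  - by move=> a aB; apply: big1 => i /eqP ei; move: aB; rewrite -ei (eP i).1.
  - by rewrite -c1 [RHS](partition_big e predT).
  - by rewrite comb_pushforward; apply: eq_bigr => i _; rewrite (eP i).2.
exists #|B|, (fun i => edge_point (enum_val i)), (fun i => z (enum_val i)).
have restrict (M : nmodType) (f : edge G -> M) :
    (forall a, a \notin B -> f a = 0) ->
    \sum_(i < #|B|) f (enum_val i) = \sum_a f a.
  move=> fB; rewrite -(big_enum_val f) big_mkcond /=.
  by apply: eq_bigr => a _; case: ifPn => // /fB.
split=> //.
- by move=> i; exists (enum_val i) => //; apply: enum_valP.
- by rewrite (restrict R z).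
- rewrite (restrict _ (fun a => z a *: edge_point a)) // => a /zB ->.
  by rewrite scale0r.
Qed.

Lemma edge_polytope_sub B B' : B \subset B' ->
  @edge_polytope R G B `<=` @edge_polytope R G B'.
Proof.
move=> /fintype.subsetP BB' q /edge_polytopeP[z [z0 zB z1 ->]].
by apply/edge_polytopeP; exists z; split=> // a aB'; apply/zB/(contra (BB' a)).
Qed.

(** At a vertex not on [a] the coordinate of the point is zero, yet it is a sum of nonnegative
    coefficients. The conclusion equates points and not edges because parallel edges share their
    point. *)
Lemma comb_edge_point_support z a b : (forall c, 0 <= z c) ->
  comb z = edge_point a -> z b != 0 -> edge_point b = edge_point a.
Proof.
move=> z0 zE zb.
have Eab : endE b = endE a.
  apply: contraNeq zb => ab; have := comb_fst z (endE b).
  rewrite zE edge_point_fst eq_sym (negPf ab) => /esym /psumr_eq0P -> //.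
have Vab : endV b = endV a.
  apply: contraNeq zb => ab; have := comb_snd z (endV b).
  rewrite zE edge_point_snd eq_sym (negPf ab) => /esym /psumr_eq0P -> //.
by rewrite /edge_point Eab Vab.
Qed.

(** If the point is a mixture of [y] and [y'] with positive weights, mixing their coefficients
    represents it by a function [m] whose support contains both supports, and all edges in that
    support have the same point. Taking all edges for [B] gives vertices of the root polytope,
    smaller [B] vertices of its simplices. *)
Lemma edge_point_vertex B a : a \in B ->
  vertices (@edge_polytope R G B) (edge_point a).
Proof.
move=> aB; split.
  apply/edge_polytopeP; exists (fun b => (b == a)%:R); split.
  - by move=> b; rewrite ler0n.
  - by move=> b; case: eqP => // ->; rewrite aB.
  - by rewrite (bigD1 a) //= eqxx big1 ?addr0 // => b /negPf ->.
  rewrite /comb (bigD1 a) //= eqxx scale1r big1 ?addr0 // => b /negPf ->.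
  by rewrite scale0r.
move=> y y' c /edge_polytopeP[z [z0 _ z1 ->]] /edge_polytopeP[z' [z'0 _ z'1 ->]].
case/andP=> c0 c1 aE.
have c1' : 0 < 1 - c by rewrite subr_gt0.
pose m b := c * z b + (1 - c) * z' b.
have m0 b : 0 <= m b by rewrite addr_ge0 // mulr_ge0 // ltW.
have mE : comb m = edge_point a.
  rewrite aE /comb !scaler_sumr -big_split /=; apply: eq_bigr => b _.
  by rewrite !scalerA -scalerDl.
have collapse (u : edge G -> R) : \sum_b u b = 1 ->
    (forall b, u b != 0 -> m b != 0) -> comb u = edge_point a.
  move=> u1 um; rewrite -[RHS]scale1r -u1 scaler_suml; apply: eq_bigr => b _.
  have [->|ub] := eqVneq (u b) 0; first by rewrite !scale0r.
  by rewrite (comb_edge_point_support m0 mE (um b ub)).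
split; apply: collapse => // b zb; apply: lt0r_neq0.
  apply: ltr_wpDr; first by rewrite mulr_ge0 // ltW.
  by rewrite mulr_gt0 // lt_def zb z0.
apply: ltr_wpDl; first by rewrite mulr_ge0 // ltW.
by rewrite mulr_gt0 // lt_def zb z'0.
Qed.

(* Dijkstra's algorithm for the arc lengths [z]: lowering [g] on the part
   already reached makes the reduced length of a shortest exit vanish. *)
Lemma shortest_path_arborescence r z : connected_map G -> (forall a, 0 <= z a) ->
  exists (A : {set darc (dual G)}) g, [/\ arborescence r A,
    forall a, 0 <= z a + coboundary g a
    & forall a, a \in A -> z a + coboundary g a = 0].
Proof.
move=> connG z0.
pose P (T : {set darc (dual G)}) := exists g,
  forall a, 0 <= z a + coboundary g a /\ (a \in T -> z a + coboundary g a = 0).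
suff [A /grown_arborescence arbA [g gP]] :
    exists2 A, grown r finset.setT A & P A.
  by exists A, g; split=> // a; have [] := gP a.
apply: grown_full.
  by exists (fun=> 0) => a; rewrite /coboundary subr0 addr0 finset.in_set0.
move=> S T grw [g gP] ST.
have [a0 [a0S a0N]] := dual_exit connG (root_in_grown grw) ST.
pose out (a : edge G) := (@src (dual G) a \in S) && (@tgt (dual G) a \notin S).
have out_a0 : out a0 by rewrite /out a0S.
pose len a := z a + coboundary g a.
case: (Order.TotalTheory.arg_minP len out_a0) => a /andP[aS aN] amin.
(* Exits of [S] lose [len a] and stay nonnegative by minimality, while entrances gain [len a],
   itself nonnegative. Arcs with both ends on the same side keep their length, so those of [T] stay
   tight. *)
exists a; split=> //; exists (fun r => g r - len a * (r \in S)%:R) => b.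
have -> : z b + coboundary (fun r => g r - len a * (r \in S)%:R) b =
    len b - len a * ((@src (dual G) b \in S)%:R - (@tgt (dual G) b \in S)%:R).
  by rewrite /len /coboundary; ring.
have [lenb0 lenbT] := gP b; have [lena0 _] := gP a.
split.
  have := amin b; rewrite /out.
  case: (@src (dual G) b \in S); case: (@tgt (dual G) b \in S) => /=;
    rewrite ?subrr ?mulr0 ?subr0 //.
    by rewrite mulr1 subr_ge0 => ->.
  by rewrite sub0r mulrN1 opprK => _; apply: addr_ge0.
rewrite in_setU1 => /predU1P[->|bT].
  by rewrite aS (negPf aN) subr0 mulr1 subrr.
have [-> ->] := grown_ends grw bT.
by rewrite subrr mulr0 subr0; apply: lenbT.
Qed.

(** * The simplices of arborescences: intersection, covering and dimension *)

Lemma arborescence_comb_inj r (A A' : {set darc (dual G)}) z z' :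
  connected_map G -> plane G -> arborescence r A -> arborescence r A' ->
  (forall a, 0 <= z a) -> (forall a, 0 <= z' a) ->
  (forall a, a \in A -> z a = 0) -> (forall a, a \in A' -> z' a = 0) ->
  comb z = comb z' -> z =1 z'.
Proof.
move=> connG planeG [_ conA] [_ conA'] z0 z'0 zA zA'.
case/(comb_eq_coboundary connG planeG) => g gE a.
(* Where [z] vanishes the coboundary is [z'], and where [z'] vanishes it is [- z]. These signs make
   [g r] both the maximum and the minimum of [g]. *)
have le_gr x : g x <= g r.
  apply: dlinked_monotone (conA x) => b bA.
  by have := z'0 b; rewrite gE zA // add0r subr_ge0.
have ge_gr x : g r <= g x.
  rewrite -lerN2; apply: (dlinked_monotone (f := fun x => - g x)) (conA' x) => b bA'.
  have := z0 b; have := gE b; rewrite zA' // => /esym/eqP.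
  by rewrite addr_eq0 => /eqP ->; rewrite oppr_ge0 subr_le0 lerN2.
have gc x : g x = g r by apply/eqP; rewrite eq_le le_gr ge_gr.
by rewrite gE /coboundary !gc subrr addr0.
Qed.

Lemma arborescence_simplexI r (A A' : {set darc (dual G)}) :
  connected_map G -> plane G -> arborescence r A -> arborescence r A' ->
  arborescence_simplex R A `&` arborescence_simplex R A' =
  @edge_polytope R G (dual_subgraph A :&: dual_subgraph A')%SET.
Proof.
move=> connG planeG arbA arbA'; apply/seteqP; split=> q; last first.
  by move=> qAA'; split; apply: edge_polytope_sub qAA';
    rewrite ?finset.subsetIl ?finset.subsetIr.
case=> /edge_polytopeP[z [z0 zA z1 ->]] /edge_polytopeP[z' [z'0 zA' z'1 zz']].
have zE : z =1 z'.
  apply: arborescence_comb_inj zz' => //; first exact: arbA.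
  - exact: arbA'.
  - by move=> a aA; apply: zA; rewrite inE negbK.
  - by move=> a aA'; apply: zA'; rewrite inE negbK.
apply/edge_polytopeP; exists z; split=> // a; rewrite inE negb_and.
by case/orP=> [/zA //|/zA']; rewrite zE.
Qed.

Lemma arborescence_simplex_cover r q : connected_map G ->
  root_polytope R G q ->
  exists2 A : {set darc (dual G)}, arborescence r A & arborescence_simplex R A q.
Proof.
move=> connG /edge_polytopeP[z [z0 _ z1 ->]].
have [A [g [arbA len0 lenA]]] := shortest_path_arborescence r connG z0.
exists A => //; apply/edge_polytopeP; exists (fun a => z a + coboundary g a).
have combE : comb (fun a => z a + coboundary g a) = comb z.
  exact: comb_coboundary.
split=> //; last by rewrite sum_comb combE -sum_comb.
by move=> a; rewrite inE negbK; apply: lenA.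
Qed.

(** [A] has one arc fewer than there are regions, and Euler's formula turns this into the edge count
    of a spanning tree of [G]. *)
Lemma card_dual_subgraph r (A : {set darc (dual G)}) : plane G ->
  arborescence r A -> #|dual_subgraph A| = (#|classE G| + #|classV G| - 1)%N.
Proof.
move=> planeG /arborescence_grown/grown_card; rewrite finset.cardsT => cardR.
have -> : dual_subgraph A = (~: (A : {set edge G}))%SET.
  by apply/setP => a; rewrite !inE.
have euler := planeG; rewrite /plane cardR -(cardsC (A : {set edge G})) in euler.
suff -> : (#|classE G| + #|classV G| = #|(~: (A : {set edge G}))%SET|.+1)%N.
  by rewrite subn1.
apply/eqP; rewrite -(eqn_add2r #|A|.+1) euler.
by apply/eqP; rewrite addn2 addSnnS !addnS; congr _.+2; apply: addnC.
Qed.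

Lemma arborescence_simplex_in r (A : {set darc (dual G)}) :
  connected_map G -> plane G -> arborescence r A ->
  simplex_in (root_polytope R G) (#|classE G| + #|classV G| - 1)%N
    (arborescence_simplex R A).
Proof.
move=> connG planeG arbA; have nE := card_dual_subgraph planeG arbA.
pose e (i : 'I_(#|classE G| + #|classV G| - 1)) : edge G :=
  enum_val (cast_ord (esym nE) i).
have e_inj : injective e.
  by move=> i j /enum_val_inj /cast_ord_inj.
exists (fun i => edge_point (e i)); split.
- by move=> i; apply: edge_point_vertex; rewrite inE.
(* A linear relation supported outside [A] is the coboundary of some [g]. It vanishes on [A], which
   connects all regions, so [g] is constant and the relation trivial. *)
- move=> c _ c0 i.
  pose z a := \sum_(j | e j == a) c j.
  have [g gE] : exists g, forall a, z a = 0 + coboundary g a.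
    apply: comb_eq_coboundary connG planeG _.
    by rewrite comb_pushforward c0 /comb big1 // => a _; rewrite scale0r.
  have zA a : a \in A -> z a = 0.
    move=> aA; apply: big1 => j /eqP ja.
    by have := enum_valP (cast_ord (esym nE) j); rewrite -/(e j) ja inE aA.
  have gA (a : darc (dual G)) : a \in A -> g (src a) = g (tgt a).
    by move=> /zA; rewrite gE add0r => /eqP; rewrite subr_eq0 => /eqP.
  have [[[_ con] _] _] := arbA.
  have <- : z (e i) = c i.
    by rewrite /z (eq_bigl (pred1 i)) ?big_pred1_eq // => j; rewrite (inj_eq e_inj).
  have gc x : g x = g r := connect_linked_const gA (con x r).
  by rewrite gE add0r /coboundary !gc subrr.
- rewrite /arborescence_simplex /edge_polytope; congr Conv.
  apply/seteqP; split=> q [].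
    move=> a aB <-; exists (cast_ord nE (enum_rank_in aB a)) => //.
    by rewrite /e cast_ordK enum_rankK_in.
  by move=> i _ <-; exists (e i) => //; apply: enum_valP.
Qed.

End Triangulation.

Local Open Scope classical_set_scope.
Local Open Scope ring_scope.

Theorem theorem1p1 (R : realType) (G : bimap) (connG : connected_map G)
    (planeG : plane G) (r0 : vertex (dual G)) :
  triangulation (root_polytope R G) (#|classE G| + #|classV G| - 1)%N
    [set arborescence_simplex R A
       | A in [set A : {set darc (dual G)} | arborescence r0 A]].
Proof.
split.
- by move=> _ [A arbA <-]; apply: arborescence_simplex_in arbA.
- apply/seteqP; split=> [q [_ [A _ <-]]|q].
    exact/edge_polytope_sub/finset.subsetT.
  case/(arborescence_simplex_cover r0 connG) => A arbA qA.
  by exists (arborescence_simplex R A) => //; exists A.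
- move=> _ _ [A arbA <-] [A' arbA' <-].
  rewrite (arborescence_simplexI R connG planeG arbA arbA').
  (* The common face is spanned by the points of the edges outside both arborescences, and these are
     vertices of either simplex. *)
  by split; eexists; try reflexivity; move=> _ [a + <-] => /=;
    rewrite inE => /andP[aA aA']; apply: edge_point_vertex.
Qed.
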